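(* Let $n>7$ be an integer, and let $M_n$ be the Möbius ladder of order $n$. Then $Aut(M_n)\cong \mathbb{D}_{2n}$, where $\mathbb{D}_{2n}$ is the dihedral group of order $2n$.
   Context: For an integer $n\geq 4$, the Möbius ladder $M_n$ on $n$ vertices (for $n$ even or odd) is the simple graph obtained from the cycle $C_n$ by additionally joining every pair of vertices $u,v$ whose distance in $C_n$ equals the diameter of $C_n$. Equivalently, if $n=2k$ is even then $M_{2k}\cong Cay(\mathbb{Z}_{2k};\{1,2k-1,k\})$, and if $n=2k+1$ is odd then $M_{2k+1}\cong Cay(\mathbb{Z}_{2k+1};\{1,2k,k,k+1\})$. Here, for an inverse closed subset $S$ of the additive cyclic group $\mathbb{Z}_n$ with $0\notin S$, $Cay(\mathbb{Z}_n;S)$ is the graph with vertex set $\mathbb{Z}_n$ in which $x,y$ are adjacent if and only if $y-x\in S$. $Aut(M_n)$ denotes the group of graph automorphisms of $M_n$. *)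

(* Defs.v *)
From mathcomp Require Import all_boot all_fingroup all_solvable.

Set Implicit Arguments.
Unset Strict Implicit.
Unset Printing Implicit Defensive.

Section Graph.

(* A simple graph is given by its adjacency relation, a symmetric and
   irreflexive relation on a finite type of vertices. *)
Variables (T : finType) (e : rel T).

Definition walk (d : nat) (x y : T) : bool :=
  [exists p : d.-tuple T, path e x p && (last x p == y)].

(* The least length of a walk from x to y. In a connected graph it is less than
   #|T|, which is the value taken when y cannot be reached from x. *)
Definition gdist (x y : T) : nat :=
  find (fun d => walk d x y) (iota 0 #|T|).

Definition gdiam : nat := \max_(x : T) \max_(y : T) gdist x y.

Definition graph_aut : {set {perm T}} :=
  [set s : {perm T} | [forall x, forall y, e (s x) (s y) == e x y]].

Lemma graph_aut_group_set : group_set graph_aut.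
Proof.
apply/group_setP; split=> [|s t].
  by rewrite inE; apply/'forall_forallP => x y; rewrite !perm1.
rewrite !inE => /'forall_'forall_eqP hs /'forall_'forall_eqP ht.
by apply/'forall_'forall_eqP => x y; rewrite !permM ht hs.
Qed.

Canonical graph_aut_group := Group graph_aut_group_set.

Lemma walk_sym d : symmetric e -> symmetric (walk d).
Proof.
move=> esym.
suff h x y : walk d x y -> walk d y x by move=> x y; apply/idP/idP; apply: h.
case/existsP=> p /andP[pp /eqP <-]; apply/existsP.
have sz : size (rev (belast x p)) == d by rewrite size_rev size_belast size_tuple.
exists (Tuple sz); rewrite /= rev_path; apply/andP; split.
  by rewrite (eq_path (e' := e)) // => a b; rewrite esym.
case: (tval p) => [|z q] /=; first by [].
by rewrite rev_cons last_rcons.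
Qed.

Lemma gdist_sym x y : symmetric e -> gdist x y = gdist y x.
Proof. by move=> esym; apply: eq_find => d; rewrite walk_sym. Qed.

Lemma gdist_eq0 x y : (gdist x y == 0) = (x == y).
Proof.
have Tgt0 : 0 < #|T| by apply/card_gt0P; exists x.
rewrite /gdist -(prednK Tgt0) /=.
have -> : walk 0 x y = (x == y).
  apply/existsP/idP => [[p]|xy]; first by rewrite (tuple0 p).
  by exists [tuple].
by case: ifP.
Qed.

End Graph.

Definition cycle_graph (n : nat) : rel 'I_n :=
  fun x y => (y == x.+1 %% n :> nat) || (x == y.+1 %% n :> nat).

Definition mobius_ladder (n : nat) : rel 'I_n :=
  fun u v =>
    cycle_graph u v || (gdist (@cycle_graph n) u v == gdiam (@cycle_graph n)).

Lemma cycle_graph_sym n : symmetric (@cycle_graph n).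
Proof. by move=> x y; rewrite /cycle_graph orbC. Qed.

Lemma mobius_ladder_sym n : symmetric (@mobius_ladder n).
Proof.
move=> x y; apply: (congr2 orb); first exact: cycle_graph_sym.
by rewrite /= gdist_sym //; exact: cycle_graph_sym.
Qed.

Lemma mobius_ladder_irr n : 1 < n -> irreflexive (@mobius_ladder n).
Proof.
move=> n_gt1 x.
have cxx : cycle_graph x x = false.
  rewrite /cycle_graph orbb.
  have [xn|nx] := ltnP x.+1 n; first by rewrite modn_small // ltn_eqF.
  have xn : x.+1 = n by apply/eqP; rewrite eqn_leq nx ltn_ord.
  by rewrite [X in X %% n]xn modnn gtn_eqF // -ltnS xn.
rewrite /mobius_ladder cxx /=.
have /eqP-> : gdist (@cycle_graph n) x x == 0 by rewrite gdist_eq0.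
apply/negbTE; rewrite eq_sym -lt0n.
pose a := Ordinal (ltnW n_gt1); pose b := Ordinal n_gt1.
apply: (@leq_trans (gdist (@cycle_graph n) a b)); first by rewrite lt0n gdist_eq0.
exact: (leq_trans (leq_bigmax b) (leq_bigmax a)).
Qed.

(* Main.v *)
(**
The adjacency of [M_n] is defined from the distance in the cycle [C_n], so every
automorphism of [C_n] is one of [M_n]. Conversely, for [n > 7], the rim
edges can be recognised inside [M_n]: for odd [n] they are the edges lying in at
most one triangle (a chord lies in two); for even [n] they are the edges [xy]
such that some path [z x y] is not part of a 4-cycle (every such path is when
[xy] is a spoke). Hence [M_n] and [C_n] have the same automorphisms, which are
the maps [x |-> i + x] and [x |-> i - x] of [Z_n]. This group has order [2n] and
is generated by the two involutions [x |-> - x] and [x |-> 1 - x].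
*)
Require Import Defs.
From mathcomp Require Import all_boot all_fingroup all_solvable.
From mathcomp Require Import ssralg zmodp zify ring.

Set Implicit Arguments.
Unset Strict Implicit.
Unset Printing Implicit Defensive.

(** * Walks and distance in a graph *)

Lemma walk0 (T : finType) (e : rel T) x y : walk e 0 x y = (x == y).
Proof.
apply/existsP/idP => [[p]|xy]; first by rewrite (tuple0 p).
by exists [tuple].
Qed.

Lemma walkS (T : finType) (e : rel T) d x y :
  walk e d.+1 x y = [exists z, e x z && walk e d z y].
Proof.
apply/existsP/existsP => [[p]|[z /andP[xz /existsP[p pp]]]].
  case/tupleP: p => z p /= /andP[/andP[xz pp] lp].
  by exists z; rewrite xz; apply/existsP; exists p; rewrite pp.
by exists [tuple of z :: p]; rewrite /= xz.
Qed.

Lemma gdist_eq (T : finType) (e : rel T) x y d :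
  d < #|T| -> walk e d x y -> (forall c, c < d -> ~~ walk e c x y) ->
  gdist e x y = d.
Proof.
(* The search range is split at [d]: the first part has no hit and the second one starts with [d]
   itself. *)
move=> dT wd wc; rewrite /gdist -(subnKC (ltnW dT)) iotaD add0n find_cat.
rewrite ifN; last first.
  by apply/hasPn => c; rewrite mem_iota add0n => /andP[_ /wc].
by rewrite size_iota -(prednK (n := #|T| - d)) ?subn_gt0 //= wd addn0.
Qed.

(** * Distance and diameter in the cycle *)

(** Truncated subtraction makes [x - y + (y - x)] the absolute difference, so this is the shorter of
    the two arcs between [x] and [y]. *)
Definition cdist n (x y : nat) : nat :=
  minn (x - y + (y - x)) (n - (x - y + (y - x))).

Lemma cycle_graphE n (x y : 'I_n) : 2 < n ->
  cycle_graph x y = (cdist n x y == 1).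
Proof.
move=> n_gt2; rewrite /cycle_graph /cdist.
have xn := ltn_ord x; have yn := ltn_ord y.
have modS (z : nat) : z < n -> z.+1 %% n = if z.+1 == n then 0 else z.+1.
  by move=> zn; case: eqP => [->|?]; [exact: modnn | apply: modn_small; lia].
rewrite !modS //; case: (x.+1 =P n); case: (y.+1 =P n); lia.
Qed.

(** Case distinctions replace reduction modulo [n], so that [lia] can handle both rim neighbours. *)
Definition csucc n (x : nat) := if x.+1 == n then 0 else x.+1.
Definition cpred n (x : nat) := if x == 0 then n.-1 else x.-1.

Lemma csucc_lt n x : x < n -> csucc n x < n.
Proof. by rewrite /csucc; case: eqP; lia. Qed.

Lemma cpred_lt n x : x < n -> cpred n x < n.
Proof. by rewrite /cpred; case: eqP; lia. Qed.

Lemma cdist_step n (x y : 'I_n) d : 2 < n -> cdist n x y = d.+1 ->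
  exists2 z : 'I_n, cycle_graph x z & cdist n z y = d.
Proof.
move=> n_gt2; have xn := ltn_ord x; have yn := ltn_ord y => xyd.
have [h|h] := eqVneq (cdist n (csucc n x) y) d.
  exists (Ordinal (csucc_lt xn)) => //.
  by rewrite cycle_graphE // /cdist /= /csucc; case: (x.+1 =P n); lia.
exists (Ordinal (cpred_lt xn)).
  by rewrite cycle_graphE // /cdist /= /cpred; case: (x =P 0 :> nat); lia.
move: h xyd; rewrite /cdist /= /csucc /cpred.
case: (x.+1 =P n); case: (x =P 0 :> nat); lia.
Qed.

Lemma cdist_lip n (x y z : 'I_n) : 2 < n ->
  cycle_graph x z -> cdist n x y <= (cdist n z y).+1.
Proof.
move=> n_gt2; rewrite cycle_graphE // /cdist.
have := ltn_ord x; have := ltn_ord y; have := ltn_ord z; lia.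
Qed.

(** Some neighbour of [x] is one closer to [y], which yields a walk of length [cdist n x y]; one
    step lowers [cdist] by at most one, so no walk is shorter. *)
Lemma gdist_cycle n (x y : 'I_n) : 2 < n ->
  gdist (@cycle_graph n) x y = cdist n x y.
Proof.
move=> n_gt2; apply: gdist_eq.
- by rewrite card_ord /cdist; have := ltn_ord x; have := ltn_ord y; lia.
- move: {2 3}(cdist n x y) (erefl (cdist n x y)) => d.
  elim: d x => [|d IHd] x xyd.
    rewrite walk0; apply/eqP/val_inj; move: xyd; rewrite /cdist /=.
    by have := ltn_ord x; have := ltn_ord y; lia.
  have [z xz zy] := cdist_step n_gt2 xyd.
  by rewrite walkS; apply/existsP; exists z; rewrite xz IHd.
- move=> c; apply: contraTN => wc; rewrite -leqNgt.
  elim: c x wc => [|c IHc] x.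
    by rewrite walk0 => /eqP->; rewrite /cdist; lia.
  rewrite walkS => /existsP[z /andP[xz /IHc zy]].
  by apply: leq_trans (cdist_lip y n_gt2 xz) _; rewrite ltnS.
Qed.

Lemma gdiam_cycle n : 2 < n -> gdiam (@cycle_graph n) = n./2.
Proof.
move=> n_gt2; apply/eqP; rewrite eqn_leq; apply/andP; split.
  apply/bigmax_leqP => x _; apply/bigmax_leqP => y _.
  by rewrite gdist_cycle // /cdist; have := ltn_ord x; have := ltn_ord y; lia.
have n_gt0 : 0 < n by lia.
have hn : n./2 < n by lia.
pose a := Ordinal n_gt0; pose b := Ordinal hn.
have <- : gdist (@cycle_graph n) a b = n./2.
  by rewrite gdist_cycle // /cdist /=; lia.
exact: (leq_trans (leq_bigmax b) (leq_bigmax a)).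
Qed.

(** * Rim edges recognised inside the ladder *)

Lemma mobius_ladderE n (x y : 'I_n) : 2 < n ->
  mobius_ladder x y = (cdist n x y == 1) || (cdist n x y == n./2).
Proof.
by move=> n_gt2; rewrite /mobius_ladder cycle_graphE // gdist_cycle // gdiam_cycle.
Qed.

(** As [d] is at most half of [n], this distance means that [y] is [x + d] or [x - d] modulo [n];
    each congruence amounts to two linear equations. *)
Lemma cdist_eqE n x y d : 0 < d -> d.*2 <= n -> x < n -> y < n ->
  (cdist n x y == d) =
  [|| x + d == y, y + d == x, x + d == y + n | y + d == x + n].
Proof. by rewrite /cdist; lia. Qed.

Lemma mobius_ladder_cases n (x y : 'I_n) : 2 < n ->
  mobius_ladder x y =
  [|| x + 1 == y, y + 1 == x, x + 1 == y + n | y + 1 == x + n] ||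
  [|| x + n./2 == y, y + n./2 == x, x + n./2 == y + n | y + n./2 == x + n].
Proof.
by move=> n_gt2; rewrite mobius_ladderE // !cdist_eqE //; lia.
Qed.

Lemma cycle_graph_cases n (x y : 'I_n) : 2 < n ->
  cycle_graph x y = [|| x + 1 == y, y + 1 == x, x + 1 == y + n | y + 1 == x + n].
Proof. by move=> n_gt2; rewrite cycle_graphE // cdist_eqE //; lia. Qed.

(** Let [n = 2k + 1] and count modulo [n]. The ends of a rim edge [x], [x + 1] have only [x + k + 1]
    as common neighbour; those of a chord [x], [x + k] have both [x - 1] and [x + k + 1]. *)
Lemma rim_odd n (x y : 'I_n) : 7 < n -> odd n ->
  cycle_graph x y =
  mobius_ladder x y &&
  [forall z, forall w, [&& mobius_ladder x z, mobius_ladder y z,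
     mobius_ladder x w & mobius_ladder y w] ==> (z == w)].
Proof.
move=> n_gt7 n_odd; have n_gt2 : 2 < n by lia.
have nE : n = n./2 + n./2 + 1 by lia.
have xn := ltn_ord x; have yn := ltn_ord y.
apply/idP/andP => [xy|[xy /'forall_forallP h]].
  split; first by rewrite mobius_ladder_cases // -cycle_graph_cases // xy.
  apply/'forall_forallP => z w; apply/implyP => /and4P[].
  move: xy; rewrite !mobius_ladder_cases // cycle_graph_cases //.
  rewrite -val_eqE /=; move: (ltn_ord z) (ltn_ord w) nE n_gt7 xn yn.
  move: (n./2) (val z) (val w) (val x) (val y); clear.
  move=> k z w x y zn wn nE n_gt7 xn yn xy xz yz xw yw; apply/eqP.
  case/or4P: xy => /eqP xy; case/orP: xz => /or4P[]/eqP xz; try lia;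
  case/orP: yz => /or4P[]/eqP yz; try lia;
  case/orP: xw => /or4P[]/eqP xw; try lia;
  case/orP: yw => /or4P[]/eqP yw; lia.
move: xy; rewrite mobius_ladder_cases // -cycle_graph_cases // => /orP[//|xy].
suff [a [b [an bn ab]]] : exists a b, [/\ a < n, b < n &
    [&& a != b, (cdist n x a == 1) || (cdist n x a == n./2),
     (cdist n y a == 1) || (cdist n y a == n./2),
     (cdist n x b == 1) || (cdist n x b == n./2) &
     (cdist n y b == 1) || (cdist n y b == n./2)]].
  have := h (Ordinal an) (Ordinal bn); rewrite !mobius_ladderE //=.
  case/and5P: ab => ab -> -> -> ->; rewrite /= -val_eqE /= => ab'.
  by rewrite ab' in ab.
have hx : 0 < n./2 by lia.
have hn : n./2.*2 <= n by lia.
have mE a b : a < n -> b < n -> (cdist n a b == 1) || (cdist n a b == n./2) =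
  [|| a + 1 == b, b + 1 == a, a + 1 == b + n | b + 1 == a + n] ||
  [|| a + n./2 == b, b + n./2 == a, a + n./2 == b + n | b + n./2 == a + n].
  by move=> an bn; rewrite !cdist_eqE //; lia.
have sx := csucc_lt xn; have sy := csucc_lt yn.
have px := cpred_lt xn; have py := cpred_lt yn.
(* The chord is read in the direction that takes [n./2] steps; the witnesses are the two rim
   vertices just outside that arc. *)
have [E|E] : (x + n./2 == y) || (x + n./2 == y + n) \/
    (y + n./2 == x) || (y + n./2 == x + n) by lia.
  exists (cpred n x), (csucc n y); split=> //; rewrite !mE //.
  move: E; rewrite /cpred /csucc.
  by case: (x =P 0 :> nat); case: (y.+1 =P n); lia.
exists (csucc n x), (cpred n y); split=> //; rewrite !mE //.
move: E; rewrite /cpred /csucc.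
by case: (y =P 0 :> nat); case: (x.+1 =P n); lia.
Qed.

(** Let [n = 2k]. As [k > 3], vertices two apart on the rim share only the vertex between them. If
    [xy] is a spoke, any other neighbour [z] of [x] lies on the rim next to [x], and its antipode is
    a second common neighbour of [y] and [z]. *)
Lemma rim_even n (x y : 'I_n) : 7 < n -> ~~ odd n ->
  cycle_graph x y =
  mobius_ladder x y &&
  [exists z, [&& mobius_ladder x z, z != y &
    [forall w, [&& mobius_ladder y w & mobius_ladder z w] ==> (w == x)]]].
Proof.
move=> n_gt7 n_even; have n_gt2 : 2 < n by lia.
have nE : n = n./2 + n./2 by lia.
have xn := ltn_ord x; have yn := ltn_ord y.
apply/idP/andP => [xy|[xy /existsP[z]]].
  split; first by rewrite mobius_ladder_cases // -cycle_graph_cases // xy.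
  (* The rim neighbour of [x] other than [y]. *)
  pose z := if y == csucc n x :> nat then cpred n x else csucc n x.
  have zn : z < n by rewrite /z; case: eqP; rewrite ?cpred_lt ?csucc_lt.
  have xyz : [|| (x + 1 == y) && ((z + 1 == x) || (z + 1 == x + n)),
                 (x + 1 == y + n) && ((z + 1 == x) || (z + 1 == x + n)),
                 (y + 1 == x) && ((x + 1 == z) || (x + 1 == z + n)) |
                 (y + 1 == x + n) && ((x + 1 == z) || (x + 1 == z + n))].
    move: xy; rewrite cycle_graph_cases // /z /csucc /cpred.
    by case: (x.+1 =P n); case: (y =P _ :> nat); case: (x =P 0 :> nat); lia.
  apply/existsP; exists (Ordinal zn); apply/and3P; split.
  - by rewrite mobius_ladder_cases //= -/z; lia.
  - by rewrite -val_eqE /= -/z; lia.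
  apply/forallP => w; apply/implyP => /andP[].
  rewrite !mobius_ladder_cases // -val_eqE /= -/z.
  move: (ltn_ord w) z xyz zn nE n_gt7 xn yn.
  move: (n./2) (val w) (val x) (val y); clear.
  move=> k w x y wn z xyz zn nE n_gt7 xn yn yw zw; apply/eqP.
  case/or4P: xyz => /andP[/eqP xy /orP[]/eqP xz]; try lia;
  case/orP: yw => /or4P[]/eqP yw; try lia;
  case/orP: zw => /or4P[]/eqP zw; lia.
case/and3P=> xz zy /forallP h; move: xy.
rewrite mobius_ladder_cases // -cycle_graph_cases // => /orP[//|xy].
have zn := ltn_ord z.
(* The antipode of [z], which closes the 4-cycle [x z w y]. *)
pose w := if z < n./2 then z + n./2 else z - n./2.
have wn : w < n by rewrite /w; case: (ltnP z n./2); lia.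
have wz : (z + n./2 == w) || (w + n./2 == z) by rewrite /w; case: (ltnP z n./2); lia.
have := h (Ordinal wn); rewrite !mobius_ladder_cases // -val_eqE /= -/w.
suff [/negbTE-> ->] : w != x /\
    [|| y + 1 == w, w + 1 == y, y + 1 == w + n | w + 1 == y + n].
  suff -> : [|| z + n./2 == w, w + n./2 == z, z + n./2 == w + n
    | w + n./2 == z + n] by rewrite orbT.
  by case/orP: wz => ->; rewrite ?orbT.
move: xz zy; rewrite mobius_ladder_cases // -val_eqE /=.
move: w wn wz zn nE n_gt7 xn yn xy.
move: (n./2) (val z) (val x) (val y); clear.
move=> k z x y w wn wz zn nE n_gt7 xn yn xy xz zy.
case/or4P: xy => /eqP xy; case/orP: xz => /or4P[]/eqP xz; try lia;
case/orP: wz => /eqP wz; lia.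
Qed.

(** * The ladder and the cycle have the same automorphisms *)

Lemma forall_perm (T : finType) (s : {perm T}) (P : pred T) :
  [forall x, P (s x)] = [forall x, P x].
Proof.
by apply/forallP/forallP => h x; [rewrite -(permKV s x); apply: h | apply: h].
Qed.

Lemma exists_perm (T : finType) (s : {perm T}) (P : pred T) :
  [exists x, P (s x)] = [exists x, P x].
Proof. by apply: negb_inj; rewrite !negb_exists (forall_perm s (predC P)). Qed.

Lemma graph_autP (T : finType) (e : rel T) (s : {perm T}) :
  reflect (forall x y, e (s x) (s y) = e x y) (s \in graph_aut e).
Proof. by rewrite inE; apply: 'forall_'forall_eqP. Qed.

Lemma walk_aut (T : finType) (e : rel T) (s : {perm T}) d x y :
  s \in graph_aut e -> walk e d (s x) (s y) = walk e d x y.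
Proof.
move=> /graph_autP hs; elim: d x => [|d IHd] x.
  by rewrite !walk0 (inj_eq perm_inj).
rewrite !walkS -(exists_perm s); apply: eq_existsb => z.
by rewrite hs IHd.
Qed.

Lemma gdist_aut (T : finType) (e : rel T) (s : {perm T}) x y :
  s \in graph_aut e -> gdist e (s x) (s y) = gdist e x y.
Proof. by move=> hs; apply: eq_find => d; rewrite walk_aut. Qed.

(** Rim adjacency is a first-order formula in ladder adjacency, so [s] preserves it once the bound
    variables are re-indexed along [s]. *)
Lemma graph_aut_mobius n : 7 < n ->
  graph_aut (@mobius_ladder n) = graph_aut (@cycle_graph n).
Proof.
move=> n_gt7; apply/setP => s; apply/idP/idP => /[dup] ms /graph_autP hs.
  apply/graph_autP => x y; have [n_odd|n_even] := boolP (odd n).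
    rewrite !(rim_odd _ _ n_gt7 n_odd) hs; apply: andb_id2l => _.
    rewrite -(forall_perm s).
    apply: eq_forallb => z; rewrite -(forall_perm s); apply: eq_forallb => w.
    by rewrite !hs (inj_eq perm_inj).
  rewrite !(rim_even _ _ n_gt7 n_even) hs; apply: andb_id2l => _.
  rewrite -(exists_perm s).
  apply: eq_existsb => z; rewrite hs (inj_eq perm_inj) -(forall_perm s).
  do 2![apply: andb_id2l => _]; apply: eq_forallb => w.
  by rewrite !hs (inj_eq perm_inj).
by apply/graph_autP => x y; rewrite /mobius_ladder hs gdist_aut.
Qed.

(** * Automorphisms of the cycle as affine maps of the residue ring *)

Import GRing.Theory.
Local Open Scope ring_scope.

Lemma cycle_graph_ring m (x y : 'I_m.+2) :
  cycle_graph x y = (y == x + 1) || (x == y + 1).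
Proof. by rewrite /cycle_graph -!val_eqE /= !modnDmr !addn1. Qed.

(** The pair [(i, false)] encodes the rotation [i + x] and [(i, true)] the reflection [i - x]; the
    sign as a power lets one formula serve both. *)
Definition dihedral_map m (a : 'I_m.+2 * bool) (x : 'I_m.+2) : 'I_m.+2 :=
  a.1 + (-1) ^+ a.2 * x.

Lemma dihedral_map_inj m a : injective (@dihedral_map m a).
Proof. by move=> x y /addrI /(can_inj (signrMK a.2)). Qed.

Definition dihedral_perm m a : {perm 'I_m.+2} := perm (@dihedral_map_inj m a).

Lemma dihedral_permE m (a : 'I_m.+2 * bool) x :
  dihedral_perm a x = a.1 + (-1) ^+ a.2 * x.
Proof. by rewrite permE. Qed.

(** Separates [x + 1] from [x - 1], that is, the two directions round the cycle. *)
Lemma Zp_two_neq0 m : 1 + 1 != 0 :> 'I_m.+3.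
Proof. by []. Qed.

Lemma dihedral_perm_inj m : injective (@dihedral_perm m.+1).
Proof.
move=> [i b] [j c] /permP e.
have := e 0; rewrite !dihedral_permE !mulr0 !addr0 /= => eij.
have := e 1; rewrite !dihedral_permE !mulr1 /= eij => /addrI/eqP.
case: b c {e} => [] [] //.
  by rewrite eq_sym -subr_eq0 opprK (negbTE (Zp_two_neq0 m)).
by rewrite -subr_eq0 opprK (negbTE (Zp_two_neq0 m)).
Qed.

Lemma dihedral_perm_aut m a : dihedral_perm a \in graph_aut (@cycle_graph m.+2).
Proof.
rewrite inE; apply/'forall_'forall_eqP => x y.
rewrite !cycle_graph_ring !dihedral_permE; case: a => i [] /=; last first.
  by rewrite !mul1r -!addrA !(inj_eq (addrI i)).
rewrite orbC !mulN1r -!addrA !(inj_eq (addrI i)).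
by congr (_ || _); rewrite -subr_eq0 -[in RHS]subr_eq0; congr (_ == 0); ring.
Qed.

(** The images of 0 and 1 fix a starting point and a direction [b]; injectivity then forces every
    later step to go the same way. *)
Lemma graph_aut_cycle m (s : {perm 'I_m.+3}) :
  s \in graph_aut (@cycle_graph m.+3) -> exists a, s = dihedral_perm a.
Proof.
rewrite inE => /'forall_'forall_eqP hs.
have [b b1] : exists b : bool, s 1 = s 0 + (-1) ^+ b.
  have := hs 0 1; rewrite !cycle_graph_ring add0r eqxx /= => /orP[/eqP->|/eqP->].
    by exists false.
  by exists true; rewrite addrK.
exists (s 0, b); apply/permP => x; rewrite dihedral_permE /= -[x]natr_Zp.
(* Two consecutive values are carried through the induction, since the next one depends on both. *)
suff [] : s x%:R = s 0 + (-1) ^+ b * x%:R /\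
          s x.+1%:R = s 0 + (-1) ^+ b * x.+1%:R by [].
elim: (x : nat) => [|k [IHk IHk1]]; first by rewrite mulr0 addr0 mulr1.
split=> //.
(* Turning back is excluded, which leaves one of the two neighbours of [s k.+1%:R]. *)
have nb : s k.+2%:R != s k%:R.
  rewrite (inj_eq perm_inj) !mulrSr -addrA -[X in _ != X]addr0 (inj_eq (addrI _)).
  exact: Zp_two_neq0.
have := hs k.+1%:R k.+2%:R.
rewrite !cycle_graph_ring [k.+2%:R]mulrSr eqxx /= -[k.+1%:R + 1]mulrSr => e.
apply/eqP; move: e nb; rewrite IHk IHk1 !mulrSr; case: b {b1 IHk IHk1} => /=.
  case/orP => /eqP e /eqP nb; first by case: nb; rewrite e; ring.
  by apply/eqP/(addIr 1); rewrite -e; ring.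
case/orP => /eqP e /eqP nb; first by apply/eqP; rewrite e; ring.
by case: nb; apply: (addIr 1); rewrite -e; ring.
Qed.

Lemma graph_aut_cycleE m :
  graph_aut (@cycle_graph m.+3) = [set dihedral_perm a | a : 'I_m.+3 * bool].
Proof.
apply/setP => s; apply/idP/imsetP => [/graph_aut_cycle[a ->]|[a _ ->]].
  by exists a.
exact: dihedral_perm_aut.
Qed.

Lemma card_graph_aut_cycle m : #|graph_aut (@cycle_graph m.+3)| = (2 * m.+3)%N.
Proof.
rewrite graph_aut_cycleE card_imset; last exact: dihedral_perm_inj.
by rewrite card_prod card_ord card_bool mulnC.
Qed.

(** * Generation by two reflections *)

Lemma dihedral_perm_reflection m (i : 'I_m.+3) :
  #[dihedral_perm (i, true)]%g = 2.
Proof.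
apply: (@nt_prime_order _ 2) => //.
  by apply/permP => x; rewrite permM perm1 !dihedral_permE /=; ring.
apply/eqP => e.
have /dihedral_perm_inj // : dihedral_perm (i, true) = dihedral_perm (0, false).
by rewrite e; apply/permP => x; rewrite perm1 dihedral_permE /= mul1r add0r.
Qed.

Lemma graph_aut_cycle_gen m : graph_aut (@cycle_graph m.+3) =
  <<[set dihedral_perm (0%R : 'I_m.+3, true); dihedral_perm (1%R, true)]>>%g.
Proof.
set A := [set _; _]; apply/eqP; rewrite eqEsubset; apply/andP; split; last first.
  rewrite gen_subG; apply/subsetP => s.
  by case/set2P => ->; exact: dihedral_perm_aut.
have s0 : dihedral_perm (0 : 'I_m.+3, true) \in <<A>>%g.
  by apply: mem_gen; apply: set21.
have s1 : dihedral_perm (1 : 'I_m.+3, true) \in <<A>>%g.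
  by apply: mem_gen; apply: set22.
rewrite graph_aut_cycleE; apply/subsetP => s /imsetP[[i b] _ ->] {s}.
have rot : dihedral_perm (i, false) \in <<A>>%g.
  rewrite -[i]natr_Zp; elim: (i : nat) => [|k IHk].
    suff -> : dihedral_perm (0 : 'I_m.+3, false) = 1%g by rewrite group1.
    by apply/permP => x; rewrite perm1 dihedral_permE /= mul1r add0r.
  (* The composite of [- x] followed by [1 - x] is the rotation by 1. *)
  suff -> : dihedral_perm (k.+1%:R : 'I_m.+3, false) =
    (dihedral_perm (k%:R, false) *
       (dihedral_perm (0%R, true) * dihedral_perm (1%R, true)))%g.
    by rewrite !groupM.
  by apply/permP => x; rewrite !permM !dihedral_permE /= mulrSr; ring.
case: b => //; suff -> : dihedral_perm (i, true) =
  (dihedral_perm (0%R, true) * dihedral_perm (i, false))%g by rewrite groupM.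
by apply/permP => x; rewrite permM !dihedral_permE /=; ring.
Qed.

Lemma graph_aut_cycle_isog n : (2 < n)%N ->
  graph_aut (@cycle_graph n) \isog 'D_(2 * n).
Proof.
case: n => [|[|[|m]]] // _.
(* With [2 * n] written as the order of the generated group, the goal says that two distinct
   involutions generate a dihedral group. *)
rewrite -card_graph_aut_cycle graph_aut_cycle_gen.
apply: involutions_gen_dihedral; rewrite ?dihedral_perm_reflection //.
by apply/eqP => /dihedral_perm_inj.
Qed.

Local Close Scope ring_scope.

Theorem theorem3p5 (n : nat) (hn : 7 < n) :
  graph_aut (@mobius_ladder n) \isog 'D_(2 * n).
Proof. by rewrite graph_aut_mobius // graph_aut_cycle_isog // (ltn_trans _ hn). Qed.
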